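(* Let $q\in\mathbb{C}$ with $0<|q|<1$, $d\in\mathbb{C}$ with $d\neq q^2$, and $j\ge0$ an integer. Then \[ \sum_{n=0}^{j} {j \brack n}_q \left(\frac{d}{q}\right)_{j-n} \left(\frac{-d}{q}\right)^n q^{n(n-1)/2}=\frac{(q)_j}{1-d/q^2} \sum_{t=0}^{j+1} \sum_{n=0}^{t} \frac{(2n-t)(d/q^2)_n(d/q^2)_{t-n}(-1)^{j+1-t}q^{(t-n)+(j-t)(j-t+1)/2}}{(q)_n(q)_{t-n}(q)_{j+1-t}}. \]
   Context: $(A)_n=(A;q)_n=\prod_{i=0}^{n-1}(1-Aq^i)$; ${j \brack n}_q=\frac{(q)_j}{(q)_n(q)_{j-n}}$ is the Gaussian binomial coefficient. *)

(* Defs.v *)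
From HB Require Import structures.
From mathcomp Require Import all_boot all_order all_algebra.
From mathcomp Require Import reals.
From mathcomp Require Export complex.

Set Implicit Arguments.
Unset Strict Implicit.
Unset Printing Implicit Defensive.

Import GRing.Theory.
Local Open Scope ring_scope.

Definition qpoch (F : fieldType) (A q : F) (n : nat) : F :=
  \prod_(i < n) (1 - A * q ^+ i).

(* Used only for n <= j, so the subtraction j - n is never truncated. *)
Definition qbinom (F : fieldType) (q : F) (j n : nat) : F :=
  qpoch q q j / (qpoch q q n * qpoch q q (j - n)).

(* Main.v *)
Require Import Defs.
From HB Require Import structures.
From mathcomp Require Import all_boot all_order all_algebra.
From mathcomp Require Import reals complex ring.

Set Implicit Arguments.
Unset Strict Implicit.
Unset Printing Implicit Defensive.

Import Order.TTheory GRing.Theory Num.Theory.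
Local Open Scope ring_scope.
Local Open Scope complex_scope.

(** Put [a = d / q^2] and consider the power series
    [f(z) = (az)_oo / (z)_oo] and [g(z) = (aqz)_oo / (z)_oo]. Since
    [f(z) = (1 - az) g(z)] and [f(qz) = (1 - z) g(z)], the Wronskian
    [z f'(z) f(qz) - z f(z) (f(qz))'], whose coefficients are the inner sums on
    the right-hand side, equals [(1 - a) z g(z)^2]. The right-hand side is thus
    the coefficient of [z^j] in [g(z)^2 (z)_oo = g(z) (aqz)_oo], up to the
    factor [(q)_j], and the left-hand side is the Cauchy product of the last two
    series. Every series involved is a quotient [(bz)_oo / (cz)_oo], and every
    product formula is an instance of
    [(az)_oo / (bz)_oo * (bz)_oo / (cz)_oo = (az)_oo / (cz)_oo]. *)

Lemma coefXM_deriv (R : nzRingType) (p : {poly R}) n :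
  ('X * p^`())`_n = p`_n *+ n.
Proof. by rewrite coefXM coef_deriv; case: n. Qed.

Lemma coefXM_wronskian (R : nzRingType) (p r : {poly R}) t :
  ('X * (p^`() * r - p * r^`()))`_t
  = \sum_(n < t.+1) ((2 * n)%:R - t%:R) * (p`_n * r`_(t - n)).
Proof.
rewrite mulrBr !mulrA -(commr_polyX p) -[p * 'X * _]mulrA coefB !coefM -sumrB.
apply: eq_bigr => n _; rewrite !coefXM_deriv mulrnAl mulrnAr.
have -> : (2 * n)%:R - t%:R = n%:R - (t - n)%:R :> R.
  by rewrite natrB -1?ltnS // mul2n -addnn natrD opprB addrA.
by rewrite mulrBl !mulr_natl.
Qed.

Lemma half_mul_predn_bin2 k : ((k.-1 * (k.-1 + 1)) %/ 2 = 'C(k, 2))%N.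
Proof. by case: k => // k; rewrite bin2 divn2 addn1 mulnC. Qed.

Lemma qpochS (F : fieldType) (a q : F) n :
  qpoch a q n.+1 = qpoch a q n * (1 - a * q ^+ n).
Proof. exact: big_ord_recr. Qed.

Section QSeries.

Variables (F : fieldType) (q : F).

(* Coefficient of [z^n] in [(bz)_oo / (cz)_oo], by the q-binomial theorem. *)
Definition qratio_coef (b c : F) (n : nat) : F :=
  \prod_(i < n) (c - b * q ^+ i) / qpoch q q n.

Lemma qratio_coef0 b c : qratio_coef b c 0 = 1.
Proof. by rewrite /qratio_coef /qpoch !big_ord0 divr1. Qed.

Lemma qratio_coef_dilate x b c n :
  qratio_coef (b * x) (c * x) n = x ^+ n * qratio_coef b c n.
Proof.
rewrite /qratio_coef mulrA; congr (_ / _).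
rewrite -[n in x ^+ n]card_ord -prodr_const -big_split.
by apply: eq_bigr => i _ /=; ring.
Qed.

Lemma qratio_coef_denom1 a n : qratio_coef a 1 n = qpoch a q n / qpoch q q n.
Proof. by []. Qed.

Lemma qratio_coef_denom0 x n :
  qratio_coef x 0 n = (- x) ^+ n * q ^+ 'C(n, 2) / qpoch q q n.
Proof.
rewrite /qratio_coef -bin2_sum big_mkord expr_sum; congr (_ / _).
rewrite -[n in (- x) ^+ n]card_ord -prodr_const -big_split.
by apply: eq_bigr => i _; rewrite /= sub0r mulNr.
Qed.

Hypothesis q_nonroot : forall n, q ^+ n.+1 != 1.

Lemma one_sub_exp_neq0 n : 1 - q ^+ n.+1 != 0.
Proof. by rewrite subr_eq0 eq_sym. Qed.

Lemma qpoch_neq0 n : qpoch q q n != 0.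
Proof. by apply/prodf_neq0 => i _; rewrite -exprS one_sub_exp_neq0. Qed.

Lemma qratio_coefS b c n :
  (1 - q ^+ n.+1) * qratio_coef b c n.+1
  = (c - b * q ^+ n) * qratio_coef b c n.
Proof.
have qn_neq1 := one_sub_exp_neq0 n; have qqn_neq0 := qpoch_neq0 n.
rewrite /qratio_coef big_ord_recr qpochS -exprS /=.
by field; apply/andP.
Qed.

(* [1 - q ^+ (m + n) = q ^+ m * (1 - q ^+ n) + (1 - q ^+ m)] splits the
   recurrence of the product into those of the two factors. *)
Lemma qratio_coef_conv a b c k :
  \sum_(n < k.+1) qratio_coef a b n * qratio_coef b c (k - n)
  = qratio_coef a c k.
Proof.
elim: k => [|k IHk]; first by rewrite big_ord1 !qratio_coef0 mulr1.
apply: (mulfI (one_sub_exp_neq0 k)); rewrite qratio_coefS -IHk !mulr_sumr.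
pose u n := q ^+ (k.+1 - n) * ((1 - q ^+ n) * qratio_coef a b n)
  * qratio_coef b c (k.+1 - n).
pose v n := qratio_coef a b n
  * ((1 - q ^+ (k.+1 - n)) * qratio_coef b c (k.+1 - n)).
transitivity (\sum_(n < k.+2) (u n + v n)).
  apply: eq_bigr => n _; rewrite /u /v.
  have -> : q ^+ k.+1 = q ^+ (k.+1 - n) * q ^+ n.
    by rewrite -exprD subnK // -ltnS.
  ring.
have u0 : u 0 = 0 by rewrite /u expr0 subrr mul0r mulr0 mul0r.
have vk : v k.+1 = 0 by rewrite /v subnn expr0 subrr mul0r mulr0.
rewrite big_split big_ord_recl /= [X in _ + X]big_ord_recr /= u0 vk add0r addr0.
rewrite -big_split; apply: eq_bigr => n _ /=.
have le_nk : (n <= k)%N by rewrite -ltnS.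
rewrite /u /v /bump add1n subSS subSn // !qratio_coefS.
have -> : q ^+ k = q ^+ (k - n) * q ^+ n by rewrite -exprD subnK.
ring.
Qed.

Definition approx_qratio (N : nat) (b c : F) (p : {poly F}) : Prop :=
  forall n, (n < N)%N -> p`_n = qratio_coef b c n.

Lemma approx_qratio_poly N b c :
  approx_qratio N b c (\poly_(i < N) qratio_coef b c i).
Proof. by move=> n lt_nN; rewrite coef_poly lt_nN. Qed.

Lemma approx_qratio_linear N a : approx_qratio N a (a * q) (1 - a *: 'X).
Proof.
have q_neq1 : 1 - q != 0 := one_sub_exp_neq0 0.
move=> n _; rewrite coefB coef1 coefZ coefX; case: n => [|[|n]].
- by rewrite qratio_coef0 mulr0 subr0.
- by rewrite /qratio_coef /qpoch !big_ord1 expr0 /=; field.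
- by rewrite /qratio_coef !big_ord_recl expr1 subrr !(mul0r, mulr0) subr0.
Qed.

Lemma approx_qratioM N a b c p r :
  approx_qratio N a b p -> approx_qratio N b c r ->
  approx_qratio N a c (p * r).
Proof.
move=> pE rE n lt_nN; rewrite coefM -(qratio_coef_conv a b).
apply: eq_bigr => i _; rewrite pE ?rE //.
- exact: leq_ltn_trans (leq_subr _ _) lt_nN.
- exact: leq_trans (ltn_ord i) lt_nN.
Qed.

Lemma qratio_wronskian N a c G t :
  approx_qratio N (a * q) c G -> (t < N)%N ->
  \sum_(n < t.+1) ((2 * n)%:R - t%:R)
    * (qratio_coef a c n * qratio_coef (a * q) (c * q) (t - n))
  = ('X * ((c - a) *: G ^+ 2))`_t.
Proof.
move=> G_approx lt_tN; pose A := (1 - a *: 'X) * G; pose B := G * (1 - c *: 'X).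
have A_approx : approx_qratio N a c A.
  exact: approx_qratioM (@approx_qratio_linear N a) G_approx.
have B_approx : approx_qratio N (a * q) (c * q) B.
  exact: approx_qratioM G_approx (@approx_qratio_linear N c).
have -> : (c - a) *: G ^+ 2 = A^`() * B - A * B^`().
  rewrite /A /B !derivM !derivB !derivZ derivX derivC -!mul_polyC polyCB.
  ring.
rewrite coefXM_wronskian; apply: eq_bigr => n _.
rewrite A_approx ?B_approx //; last exact: leq_trans (ltn_ord n) lt_tN.
exact: leq_ltn_trans (leq_subr _ _) lt_tN.
Qed.

Lemma qratio_wronskian_conv a b c j :
  \sum_(t < j.+2) (\sum_(n < t.+1) ((2 * n)%:R - t%:R)
      * (qratio_coef a c n * qratio_coef (a * q) (c * q) (t - n)))
    * qratio_coef c b (j.+1 - t)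
  = (c - a) * \sum_(n < j.+1) qratio_coef (a * q) b n
                              * qratio_coef (a * q) c (j - n).
Proof.
pose G := \poly_(i < j.+2) qratio_coef (a * q) c i.
pose E := \poly_(i < j.+2) qratio_coef c b i.
have G_approx := @approx_qratio_poly j.+2 (a * q) c.
have E_approx := @approx_qratio_poly j.+2 c b.
transitivity (('X * ((c - a) *: G ^+ 2) * E)`_j.+1).
  rewrite coefM; apply: eq_bigr => t _.
  by rewrite (qratio_wronskian G_approx) // E_approx // ltnS leq_subr.
rewrite -mulrA coefXM /= -scalerAl coefZ expr2 -mulrA [G * _]mulrC coefM.
congr (_ * _); apply: eq_bigr => n _.
rewrite (approx_qratioM G_approx E_approx) ?G_approx //; last exact: leqW.
exact: leq_ltn_trans (leq_subr _ _) (leqnSn _).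
Qed.

Lemma qbinom_sum_qratio x j :
  \sum_(n < j.+1)
    qbinom q j n * qpoch x q (j - n) * (- x) ^+ n * q ^+ ((n * (n - 1)) %/ 2)
  = qpoch q q j * \sum_(n < j.+1) qratio_coef x 0 n * qratio_coef x 1 (j - n).
Proof.
rewrite mulr_sumr; apply: eq_bigr => n _.
rewrite /qbinom qratio_coef_denom0 qratio_coef_denom1 bin2 divn2 subn1.
by field; rewrite !qpoch_neq0.
Qed.

Lemma qpoch_sum_qratio a j :
  \sum_(t < j.+2) \sum_(n < t.+1)
    ((2 * n)%:R - t%:R) * qpoch a q n * qpoch a q (t - n) * (-1) ^+ (j.+1 - t)
      * q ^+ ((t - n) + ((j - t) * (j - t + 1)) %/ 2)
    / (qpoch q q n * qpoch q q (t - n) * qpoch q q (j.+1 - t))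
  = \sum_(t < j.+2) (\sum_(n < t.+1) ((2 * n)%:R - t%:R)
      * (qratio_coef a 1 n * qratio_coef (a * q) (1 * q) (t - n)))
    * qratio_coef 1 0 (j.+1 - t).
Proof.
apply: eq_bigr => t _; rewrite mulr_suml; apply: eq_bigr => n _.
rewrite -[(j - t)%N]subSKn half_mul_predn_bin2 exprD.
rewrite qratio_coef_dilate qratio_coef_denom0 !qratio_coef_denom1.
by field; rewrite !qpoch_neq0.
Qed.

End QSeries.

Lemma exprn_neq1 (R : numDomainType) (x : R) n :
  (0 < n)%N -> `|x| < 1 -> x ^+ n != 1.
Proof.
move=> n_gt0; apply: contraTneq => xn1.
by rewrite -(expr_lt1 n_gt0) // -normrX xn1 normr1 ltxx.
Qed.

(* On the right-hand side the natural-number exponent (j - t)(j - t + 1)/2 is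
   truncated only at t = j + 1, where both readings give 0. *)
Theorem theorem6p2 (R : realType) (q d : R[i]) (j : nat)
    (hq : 0 < `|q| < 1) (hd : d != q ^+ 2) :
  \sum_(0 <= n < j.+1)
      qbinom q j n * qpoch (d / q) q (j - n) * (- d / q) ^+ n
        * q ^+ ((n * (n - 1)) %/ 2)
  = qpoch q q j / (1 - d / q ^+ 2) *
    \sum_(0 <= t < j.+2) \sum_(0 <= n < t.+1)
      ((2 * n)%:R - t%:R) * qpoch (d / q ^+ 2) q n
        * qpoch (d / q ^+ 2) q (t - n) * (-1) ^+ (j.+1 - t)
        * q ^+ ((t - n) + ((j - t) * (j - t + 1)) %/ 2)
      / (qpoch q q n * qpoch q q (t - n) * qpoch q q (j.+1 - t)).
Proof.
have /andP[q_gt0 q_lt1] := hq.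
have q_neq0 : q != 0 by rewrite -normr_gt0.
have q_nonroot n : q ^+ n.+1 != 1 by apply: exprn_neq1.
set a := d / q ^+ 2.
have a_neq1 : 1 - a != 0.
  by rewrite subr_eq0 eq_sym; apply: contra hd => /eqP /divr1_eq ->.
have aqE : d / q = a * q by rewrite /a; field.
rewrite mulNr aqE !big_mkord.
under [in RHS]eq_bigr do rewrite big_mkord.
rewrite qbinom_sum_qratio // qpoch_sum_qratio // qratio_wronskian_conv //.
by rewrite mulrA divfK.
Qed.
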